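(* Suppose that the parareal algorithm is initialized by local forecasting, i.e. $\mathbf x_0^{n+1}=\mathcal G_{\mathrm{LF}}(\mathbf x_0^n;T^n,T^{n+1})$ for $n=0,\dots,M-1$, that the coarse propagator is $\mathcal G=\mathcal G_{\mathrm{LF}}$, that the number of processors equals the number $M$ of coarse time intervals, and that the wall time incurred by computing time advancement over one fine time step with the fine propagator dominates all other costs and parallel overhead. Then, upon convergence in $K$ parareal iterations, the method realizes a speedup of $$S_{\mathrm{LF\text{-}LF}}(K)=\frac{m}{\left[\alpha\left(M-\frac K2\right)+\bar m\right](K+1)-\alpha(K+1)}.$$
   Context: Let $N,M,\bar m$ be positive integers, $m=\bar m M$, $T_{\mathrm{final}}>0$, $h=T_{\mathrm{final}}/m$, $H=\bar m h$; fine time instances $t^i=ih$ ($0\le i\le m$), coarse time instances $T^n=nH=t^{\bar m n}$ ($0\le n\le M$). The fine propagator $\mathcal F(\boldsymbol\xi;t^i,t^j)\in\mathbb R^N$ propagates a state $\boldsymbol\xi\in\mathbb R^N$ from $t^i$ to $t^j$ ($i\le j$), with $\mathcal F(\cdot;t^i,t^k)=\mathcal F(\cdot;t^j,t^k)\circ\mathcal F(\cdot;t^i,t^j)$ for $i\le j\le k$; it typically corresponds to a single-step time integrator. $\mathbf x^0\in\mathbb R^N$ is the initial state. The local-forecast coarse propagator with memory $\alpha\in\mathbb N$, $1\le\alpha\le\bar m$, is $$\mathcal G_{\mathrm{LF}}(\boldsymbol\xi;T^n,T^{n+1})=\mathbf P\mathbf R^T\boldsymbol\xi+\mathbf P\sum_{i=1}^{\alpha}\boldsymbol\Gamma_i^n[\mathbf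 R^T\mathcal F(\boldsymbol\xi;T^n,t^{\bar m n+i})-\mathbf R^T\boldsymbol\xi],$$ with restriction operator $\mathbf R^T$ and prolongation operator $\mathbf P$, $\mathbf R,\mathbf P\in\mathbb R^{N\times\bar N}$ ($1\le\bar N\le N$), and $\boldsymbol\Gamma_i^n=\mathrm{diag}(\gamma_{i1}^n,\dots,\gamma_{i\bar N}^n)$ with $\gamma_{ij}^n=\mathbf e_{\bar m}^T\boldsymbol\Xi_j^n[\mathbf Z_0\boldsymbol\Xi_j^n]^+\mathbf e_i$, where $\boldsymbol\Xi_j^n\in\mathbb R^{\bar m\times a}$ ($a\le\alpha$) are given matrices with orthonormal columns (local time-evolution bases), $\mathbf Z_0$ extracts the first $\alpha$ entries of a vector in $\mathbb R^{\bar m}$, $^+$ is the Moore--Penrose pseudoinverse and $\mathbf e_i$ are canonical unit vectors. The $\alpha$ applications of the fine propagator employed by the local-forecast coarse propagator on a coarse interval are reused during the subsequent fine propagation there. Parareal algorithm (inputs $\mathcal F$, $\mathcal G$, $\mathbf x_0^0=\mathbf x^0$, tolerance $\epsilon$): (1) compute an initialization $\mathbf x_0^1,\dots,\mathbf x_0^M$. (2) In parallel, $\mathbf f_0^{n+1}=\mathcal F(\mathbf x_0^n;T^n,T^{n+1})$, $n=0,\dots,M-1$; set $k=0$. (3) While $\|\mathbf f_k^n-\mathbf x_k^n\|/\|\mathbf f_k^n\|>\epsilon$ for some $n\in\{k+1,\dots,M-1\}$: (a) if $k=0$, compute in parallel $\mathbf g_0^{n+1}=\mathcal G(\mathbf x_0^n;T^n,T^{n+1})$,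 $n=1,\dots,M-1$ (and $\mathbf g_0^1=\mathbf g_1^1$); (b) $\mathbf x_{k+1}^k=\mathbf x_k^k$; (c) serially for $n=k,\dots,M-1$: $\mathbf g_{k+1}^{n+1}=\mathcal G(\mathbf x_{k+1}^n;T^n,T^{n+1})$, $\mathbf x_{k+1}^{n+1}=\mathbf g_{k+1}^{n+1}+\mathbf f_k^{n+1}-\mathbf g_k^{n+1}$; (d) in parallel $\mathbf f_{k+1}^{n+1}=\mathcal F(\mathbf x_{k+1}^n;T^n,T^{n+1})$, $n=k,\dots,M-1$; then $k\leftarrow k+1$. (4) Replace $\mathbf x_k^{n+1}$ by $\mathbf f_k^{n+1}$, $n=k,\dots,M-1$. $K$ denotes the final value of $k$ (the number of parareal iterations). Speedup is the ratio of the wall time of the serial solution with the fine propagator (over all $m$ fine time steps) to the wall time of the parareal method. *)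

(* Defs.v *)
From HB Require Import structures.
From mathcomp Require Import all_boot all_order all_algebra.
From mathcomp Require Import mathcomp_extra boolp classical_sets reals.

Set Implicit Arguments.
Unset Strict Implicit.
Unset Printing Implicit Defensive.

Import Order.TTheory GRing.Theory Num.Theory.
Local Open Scope ring_scope.

Section MoorePenrose.
Variable R : realType.

Definition is_pseudoinverse (m n : nat) (A : 'M[R]_(m, n)) (X : 'M[R]_(n, m)) :
    Prop :=
  [/\ A *m X *m A = A, X *m A *m X = X,
      (A *m X)^T = A *m X & (X *m A)^T = X *m A].

(* MathComp's [pinvmx] only satisfies the first of the four Penrose equations. *)
Definition mp_inverse (m n : nat) (A : 'M[R]_(m, n)) : 'M[R]_(n, m) :=
  xget 0 (fun X => is_pseudoinverse A X).

Lemma row_free_gram (m n : nat) (B : 'M[R]_(m, n)) :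
  row_free B -> B *m B^T \in unitmx.
Proof.
move=> freeB; rewrite -row_free_unit -kermx_eq0; apply/eqP/row_matrixP => i.
rewrite row0; set v := row i _.
have vG : v *m (B *m B^T) = 0 by apply/sub_kermxP; rewrite row_sub.
suff vB : v *m B = 0 by apply: (row_free_inj freeB); rewrite vB mul0mx.
have : (v *m B *m (v *m B)^T) 0 0 = 0.
  by rewrite trmx_mul mulmxA -(mulmxA v) vG mul0mx mxE.
rewrite mxE => /eqP; rewrite psumr_eq0 => [/allP w0|j _]; last first.
  by rewrite [X in _ * X]mxE -expr2 sqr_ge0.
apply/rowP => j; have := w0 j (mem_index_enum j).
by rewrite [_^T _ _]mxE /= mulf_eq0 orbb => /eqP ->; rewrite mxE.
Qed.

Lemma full_rank_pseudoinverse (m n r : nat) (C : 'M[R]_(m, r))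
    (B : 'M[R]_(r, n)) :
  C^T *m C \in unitmx -> B *m B^T \in unitmx ->
  is_pseudoinverse (C *m B)
    (B^T *m invmx (B *m B^T) *m (invmx (C^T *m C) *m C^T)).
Proof.
move=> uC uB; set X := _ *m (_ *m _).
have tB : (invmx (B *m B^T))^T = invmx (B *m B^T).
  by rewrite trmx_inv trmx_mul trmxK.
have tC : (invmx (C^T *m C))^T = invmx (C^T *m C).
  by rewrite trmx_inv trmx_mul trmxK.
have AX : C *m B *m X = C *m invmx (C^T *m C) *m C^T.
  by rewrite /X !mulmxA -(mulmxA C B) -(mulmxA C) mulmxV // mulmx1.
have XA : X *m (C *m B) = B^T *m invmx (B *m B^T) *m B.
  rewrite /X !mulmxA -(mulmxA _ C^T C).
  by rewrite -(mulmxA _ (invmx (C^T *m C))) mulVmx // mulmx1.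
split.
- rewrite AX !mulmxA -(mulmxA _ C^T C).
  by rewrite -(mulmxA C) mulVmx // mulmx1.
- rewrite XA /X !mulmxA -(mulmxA _ B B^T).
  by rewrite -(mulmxA _ (B *m B^T)) mulmxV // mulmx1.
- by rewrite AX !trmx_mul tC trmxK mulmxA.
- by rewrite XA !trmx_mul tB trmxK mulmxA.
Qed.

Lemma mp_inverseP (m n : nat) (A : 'M[R]_(m, n)) :
  is_pseudoinverse A (mp_inverse A).
Proof.
apply: (@xgetPex _ 0 (fun X => is_pseudoinverse A X)).
rewrite -[A]mulmx_base; eexists; apply: full_rank_pseudoinverse.
  have := @row_free_gram _ _ (col_base A)^T; rewrite trmxK; apply.
  by rewrite /row_free mxrank_tr; have := col_base_full A; rewrite /row_full.
exact/row_free_gram/row_base_free.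
Qed.

End MoorePenrose.

Section Time.
Variables (R : realType) (M mbar : nat) (Tfinal : R).

Definition fine_time (i : nat) : R := i%:R * (Tfinal / (mbar * M)%N%:R).

Definition coarse_time (n : nat) : R := fine_time (mbar * n).

(* [F xi s t] propagates the state [xi] from time [s] to time [t]. *)
Definition fine_propagator (N : nat) (F : 'cV[R]_N -> R -> R -> 'cV[R]_N) :
    Prop :=
  forall i j k : nat, (i <= j)%N -> (j <= k)%N -> (k <= mbar * M)%N ->
  forall xi : 'cV[R]_N,
    F xi (fine_time i) (fine_time k) =
    F (F xi (fine_time i) (fine_time j)) (fine_time j) (fine_time k).

End Time.

(* [cp_map n xi] is the approximation at T^{n+1} of the state starting from
   [xi] at T^n; its evaluation uses the fine states at the first [cp_steps] fine
   time instances following T^n on the trajectory issued from [xi]. *)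
Record coarse_propagator (R : realType) (N : nat) := CoarsePropagator {
  cp_map : nat -> 'cV[R]_N -> 'cV[R]_N;
  cp_steps : nat
}.

Section LocalForecast.
Variables (R : realType) (N Nbar M mbar alpha a : nat) (Tfinal : R).
Variable F : 'cV[R]_N -> R -> R -> 'cV[R]_N.
Variables Rr P : 'M[R]_(N, Nbar).
Variable Xi : nat -> 'I_Nbar -> 'M[R]_(mbar, a).

Definition sampling : 'M[R]_(alpha, mbar) := pid_mx alpha.

Definition last_unit : 'cV[R]_mbar := \col_l (l.+1 == mbar)%:R.

(* Indices are 0-based: i : 'I_alpha stands for i+1 in {1, ..., alpha}. *)
Definition forecast_coef (n : nat) (i : 'I_alpha) (j : 'I_Nbar) : R :=
  (last_unit^T *m Xi n j *m mp_inverse (sampling *m Xi n j)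
     *m (delta_mx i 0 : 'cV_alpha)) 0 0.

Definition forecast_mx (n : nat) (i : 'I_alpha) : 'M[R]_Nbar :=
  diag_mx (\row_j forecast_coef n i j).

Definition local_forecast_map (n : nat) (xi : 'cV[R]_N) : 'cV[R]_N :=
  P *m Rr^T *m xi +
  P *m \sum_(i < alpha) forecast_mx n i *m
    (Rr^T *m F xi (coarse_time M mbar Tfinal n)
                  (fine_time M mbar Tfinal (mbar * n + i.+1))
     - Rr^T *m xi).

Definition local_forecast : coarse_propagator R N :=
  CoarsePropagator local_forecast_map alpha.

End LocalForecast.

(* Everything the algorithms do apart from advancing over fine time steps,
   including the overhead of starting and synchronizing the parallel phases. *)
Inductive activity : Type :=
| SerialSolve
| Initialize of nat
| FirstCoarse of nat
| FirstCoarseSync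
| Test of nat
| Copy of nat
| Coarse of nat & nat
| Correct of nat & nat
| Fine of nat & nat
| FineSync of nat
| Replace of nat.

Record costs (R : realType) := Costs {
  step_time : R;
  other_time : activity -> R
}.

(* With [eta = 0] every cost other than that of the fine time steps vanishes. *)
Definition fine_step_dominates (R : realType) (eta : R) (c : costs R) : Prop :=
  0 < step_time c /\
  forall act, 0 <= other_time c act <= eta * step_time c.

(* Wall time of M independent tasks of durations [w] on p processors: minimum,
   over the assignments of tasks to processors, of the largest processor load.
   The neutral element (total load) is an upper bound of all these values. *)
Definition parallel_time (R : realType) (M p : nat) (w : 'I_M -> R) : R :=
  \big[Num.min/(\sum_n w n)]_(s : {ffun 'I_M -> 'I_p})
    \big[Num.max/0]_(q < p) \sum_(n | s n == q) w n.

(* The state at the start of a coarse interval, together with the number of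
   fine time steps of that interval already computed from it. *)
Record tracked (V : Type) := Tracked { value : V; steps_done : nat }.

Definition fresh (V : Type) (v : V) : tracked V := Tracked v 0.

Definition reach (V : Type) (j : nat) (u : tracked V) : tracked V :=
  Tracked (value u) (maxn (steps_done u) j).

(* Only the steps that are not yet available have to be computed. *)
Definition reach_time (R : realType) (c : costs R) (V : Type) (j : nat)
    (u : tracked V) : R :=
  (j - steps_done u)%N%:R * step_time c.

(* The arrays are indexed as x_k^n, f_k^n, g_k^n; [clock] is the wall time. *)
Record pstate (R : realType) (N : nat) := PState {
  xs : nat -> nat -> tracked 'cV[R]_N;
  fs : nat -> nat -> 'cV[R]_N;
  gs : nat -> nat -> 'cV[R]_N;
  clock : R
}.

(* h_k^n := v n for lo <= n < hi. *)
Definition assign (T : Type) (h : nat -> nat -> T) (k lo hi : nat)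
    (v : nat -> T) : nat -> nat -> T :=
  fun k' n => if (k' == k) && (lo <= n < hi)%N then v n else h k' n.

Definition assign1 (T : Type) (h : nat -> nat -> T) (k n : nat) (v : T) :
    nat -> nat -> T :=
  assign h k n n.+1 (fun _ => v).

Definition norm2 (R : realType) (N : nat) (v : 'cV[R]_N) : R :=
  Num.sqrt (\sum_i v i 0 ^+ 2).

Section Parareal.
Variables (R : realType) (N M mbar : nat) (Tfinal : R) (p : nat).
Variables (F : 'cV[R]_N -> R -> R -> 'cV[R]_N) (x0 : 'cV[R]_N) (eps : R).
(* G0 is the propagator used serially for the initialization. *)
Variables (G0 G : coarse_propagator R N).
Variable c : costs R.

Local Notation state := (pstate R N).
Local Notation other := (other_time c).

Definition tick (w : R) (s : state) : state :=
  PState (xs s) (fs s) (gs s) (clock s + w).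

Definition start : state :=
  PState (fun k n => fresh (if (k == 0%N) && (n == 0%N) then x0 else 0))
         (fun _ _ => 0) (fun _ _ => 0) 0.

Definition init_step (s : state) (n : nat) : state :=
  let u := xs s 0 n in
  PState
    (assign1 (assign1 (xs s) 0 n (reach (cp_steps G0) u))
       0 n.+1 (fresh (cp_map G0 n (value u))))
    (fs s) (gs s)
    (clock s + reach_time c (cp_steps G0) u + other (Initialize n)).

Definition initialize : state := foldl init_step start (index_iota 0 M).

(* f_k^{n+1} = F (x_k^n; T^n, T^{n+1}) in parallel for n = lo, ..., M-1. *)
Definition fine_phase (k lo : nat) (s : state) : state :=
  PState
    (assign (xs s) k lo M (fun n => reach mbar (xs s k n)))
    (assign (fs s) k lo.+1 M.+1 (fun n =>
       F (value (xs s k n.-1)) (coarse_time M mbar Tfinal n.-1)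
                               (coarse_time M mbar Tfinal n)))
    (gs s)
    (clock s + other (FineSync k) +
       parallel_time p (fun n : 'I_M =>
         if (lo <= n)%N then reach_time c mbar (xs s k n) + other (Fine k n)
         else 0)).

Definition first_coarse_phase (s : state) : state :=
  PState
    (assign (xs s) 0 1 M (fun n => reach (cp_steps G) (xs s 0 n)))
    (fs s)
    (assign (gs s) 0 2 M.+1 (fun n => cp_map G n.-1 (value (xs s 0 n.-1))))
    (clock s + other FirstCoarseSync +
       parallel_time p (fun n : 'I_M =>
         if (1 <= n)%N
         then reach_time c (cp_steps G) (xs s 0 n) + other (FirstCoarse n)
         else 0)).

(* The copied state keeps the fine time steps already computed from it. *)
Definition copy (k : nat) (s : state) : state :=
  PState (assign1 (xs s) k.+1 k (xs s k k)) (fs s) (gs s)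
         (clock s + other (Copy k)).

Definition coarse_step (k : nat) (s : state) (n : nat) : state :=
  let u := xs s k.+1 n in
  let gnew := cp_map G n (value u) in
  let g1 := assign1 (gs s) k.+1 n.+1 gnew in
  (* g_0^1 = g_1^1 *)
  let g2 := if (k == 0%N) && (n == 0%N) then assign1 g1 0 1 gnew else g1 in
  PState
    (assign1 (assign1 (xs s) k.+1 n (reach (cp_steps G) u))
       k.+1 n.+1 (fresh (g2 k.+1 n.+1 + fs s k n.+1 - g2 k n.+1)))
    (fs s) g2
    (clock s + reach_time c (cp_steps G) u + other (Coarse k n)
       + other (Correct k n)).

Definition coarse_sweep (k : nat) (s : state) : state :=
  foldl (coarse_step k) s (index_iota k M).

Definition iteration (k : nat) (s : state) : state :=
  fine_phase k.+1 k
    (coarse_sweep k (copy k (if k == 0%N then first_coarse_phase s else s))).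

Definition unconverged (k : nat) (s : state) : bool :=
  has (fun n => eps < norm2 (fs s k n - value (xs s k n)) / norm2 (fs s k n))
      (index_iota k.+1 M).

Definition replace_final (k : nat) (s : state) : state :=
  PState (assign (xs s) k k.+1 M.+1 (fun n => fresh (fs s k n)))
         (fs s) (gs s) (clock s + other (Replace k)).

(* The while loop: entered with counter [k] in the first state, left with
   counter [K] in the second one. *)
Inductive loop : nat -> state -> nat -> state -> Prop :=
| loop_exit k s of ~~ unconverged k s :
    loop k s k (tick (other (Test k)) s)
| loop_next k s K t of unconverged k s &
    loop k.+1 (iteration k (tick (other (Test k)) s)) K t :
    loop k s K t.

(* The algorithm converges in K iterations, ending in state [out]. *)
Definition parareal (K : nat) (out : state) : Prop :=
  exists2 s, loop 0 (fine_phase 0 0 initialize) K s & out = replace_final K s.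

Definition serial_time : R :=
  (mbar * M)%N%:R * step_time c + other SerialSolve.

Definition speedup (out : state) : R := serial_time / clock out.

End Parareal.

(* Main.v *)
Require Import Defs.
From HB Require Import structures.
From mathcomp Require Import all_boot all_order all_algebra.
From mathcomp Require Import mathcomp_extra boolp classical_sets reals.
From mathcomp Require Import zify ring lra.
Import Order.TTheory GRing.Theory Num.Theory.
Local Open Scope ring_scope.

(* A coarse interval costs alpha fine steps in the serial sweep and, as these
   are reused, only mbar - alpha more in the parallel phase.  The state copied
   at the beginning of iteration k is already fully propagated, so the sweep of
   iteration k costs alpha (M - 1 - k) instead of alpha (M - k).  An unconverged
   test at k forces k + 1 < M, so the parallel phase is never void, and K < M.
   Summing over k < K gives the denominator.  The other activities on the
   critical path are bounded in number by a function of M and K, so the speedup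
   converges as their relative cost eta tends to 0. *)

(** * Wall time of a parallel phase with as many processors as tasks *)

(** Whatever the assignment, the processor that receives [n0] is busy for at least [w n0]; assigning
    one task to each processor keeps every load below [hi]. *)
Lemma parallel_time_bounds (R : realType) (M : nat) (w : 'I_M -> R)
    (lo hi : R) (n0 : 'I_M) :
  (forall n, 0 <= w n <= hi) -> lo <= w n0 ->
  lo <= parallel_time M w <= hi.
Proof.
move=> hw hlo.
have w_ge0 n : 0 <= w n by case/andP: (hw n).
have load_ge (Q : pred 'I_M) : Q n0 -> lo <= \sum_(n | Q n) w n.
  move=> Qn0; apply: le_trans hlo _; rewrite (bigD1 n0) //= lerDl.
  by apply: sumr_ge0 => n _.
apply/andP; split.
  apply: le_bigmin => [|s _]; first exact: load_ge.
  apply: le_trans (le_bigmax _ _ (s n0)).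
  by apply: load_ge => /=.
apply: le_trans (bigmin_le _ [ffun n => n] _) _.
apply: bigmax_le => [|q _]; first by case/andP: (hw n0) => /le_trans h /h.
rewrite (eq_bigl (pred1 q)) => [|n]; last by rewrite ffunE.
by rewrite big_pred1_eq; case/andP: (hw q).
Qed.

(** * Counting fine steps and perturbing a quotient *)

(* Total number of fine steps on the critical path when the while loop is
   entered with counter [k]. *)
Definition critical_steps (M mbar alpha k : nat) : nat :=
  (alpha * M + (mbar - alpha)
   + \sum_(i < k) (alpha * (M - i.+1) + (mbar - alpha)))%N.

(** By induction; the hypotheses make the truncated subtractions [mbar - alpha] and [M - i.+1]
    exact. *)
Lemma critical_stepsE (R : realType) (M mbar alpha k : nat) :
  (alpha <= mbar)%N -> (k < M)%N ->
  (critical_steps M mbar alpha k)%:R =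
  (alpha%:R * (M%:R - k%:R / 2) + mbar%:R) * (k%:R + 1)
    - alpha%:R * (k%:R + 1) :> R.
Proof.
move=> le_am; rewrite /critical_steps; elim: k => [|k IHk] ltkM.
  by rewrite big_ord0 addn0 natrD natrM natrB //; field.
rewrite big_ord_recr /= addnA natrD IHk; last exact: ltnW.
by rewrite natrD natrM !natrB // ?(ltnW ltkM) // -!natr1; field.
Qed.

(** The difference equals [(T * e1 - x * e2) / (T * (T + e2))], whose denominator is at least
    [T ^+ 2]. *)
Lemma ratio_perturbation (R : realType) (x T B eta e1 e2 : R) :
  0 <= x -> 0 < T -> 0 <= e1 <= eta -> 0 <= e2 <= B * eta ->
  `|(x + e1) / (T + e2) - x / T| <= (T + x * B) * eta / T ^+ 2.
Proof.
move=> x0 T0 /andP[e10 e1le] /andP[e20 e2le].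
have T_ge0 := ltW T0.
have Te : 0 < T + e2 by rewrite ltr_wpDr.
have -> : (x + e1) / (T + e2) - x / T = (T * e1 - x * e2) / (T * (T + e2)).
  by field; rewrite !gt_eqF.
rewrite normrM normfV (gtr0_norm (mulr_gt0 T0 Te)).
have e0 : 0 <= eta := le_trans e10 e1le.
apply: ler_pM => //; first by rewrite invr_ge0 ltW ?mulr_gt0.
  rewrite mulrDl -mulrA; apply: le_trans (ler_normB _ _) _.
  rewrite !ger0_norm ?mulr_ge0 //.
  by apply: lerD; rewrite ler_wpM2l.
rewrite lef_pV2 ?posrE ?exprn_gt0 ?mulr_gt0 // expr2 ler_wpM2l //.
by rewrite lerDl.
Qed.

(** * Costs measured in fine steps and other activities *)

Section WallTime.
Set Implicit Arguments.
Unset Strict Implicit.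
Variables (R : realType) (N M mbar alpha : nat) (Tfinal eps : R).
Variables (F : 'cV[R]_N -> R -> R -> 'cV[R]_N) (x0 : 'cV[R]_N).
Variables (G0 G : coarse_propagator R N).
Variables (eta : R) (c : costs R).
Hypothesis G0_steps : cp_steps G0 = alpha.
Hypothesis G_steps : cp_steps G = alpha.
Hypothesis le_alpha : (alpha <= mbar)%N.
Hypothesis dominates : fine_step_dominates eta c.

Local Notation tau := (step_time c).
Local Notation done s k n := (steps_done (xs s k n)).

(* [w] consists of [A] fine steps and at most [B] other activities. *)
Definition cost_within (A B : nat) (w : R) : bool :=
  A%:R * tau <= w <= (A%:R + B%:R * eta) * tau.

Lemma step_time_gt0 : 0 < tau.
Proof. by case: dominates. Qed.

Lemma other_within act : cost_within 0 1 (other_time c act).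
Proof. by case: dominates => _ /(_ act); rewrite /cost_within mul0r add0r mul1r. Qed.

Lemma dominates_eta_ge0 : 0 <= eta.
Proof.
have /andP[] := other_within SerialSolve.
rewrite mul0r add0r mul1r => h /(le_trans h).
by rewrite pmulr_lge0 // step_time_gt0.
Qed.

Lemma steps_within (A : nat) : cost_within A 0 (A%:R * tau).
Proof. by rewrite /cost_within mul0r addr0 lexx. Qed.

Lemma cost_within_add A B A' B' w w' :
  cost_within A B w -> cost_within A' B' w' ->
  cost_within (A + A') (B + B') (w + w').
Proof.
move=> /andP[h1 h2] /andP[h3 h4]; rewrite /cost_within !natrD.
by apply/andP; split; lra.
Qed.

Lemma cost_within_le A A' B w :
  (A <= A')%N -> cost_within A B w -> 0 <= w <= (A'%:R + B%:R * eta) * tau.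
Proof.
move=> leA /andP[h1 h2]; have tau0 := ltW step_time_gt0.
apply/andP; split; first by apply: le_trans h1; rewrite mulr_ge0.
by apply: le_trans h2 _; rewrite ler_wpM2r // lerD2r ler_nat.
Qed.

Lemma cost_within_widen A B B' w :
  (B <= B')%N -> cost_within A B w -> cost_within A B' w.
Proof.
move=> leB /andP[h1 h2]; rewrite /cost_within h1; apply: le_trans h2 _.
rewrite ler_wpM2r ?(ltW step_time_gt0) // lerD2l.
by rewrite ler_wpM2r ?dominates_eta_ge0 // ler_nat.
Qed.

Lemma reach_within j (u : tracked 'cV[R]_N) :
  cost_within (j - steps_done u) 0 (reach_time c j u).
Proof. exact: steps_within. Qed.

(** One task with exactly [A] fine steps yields the lower bound; the others may have fewer. *)
Lemma parallel_within A B (w : 'I_M -> R) (n0 : 'I_M) :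
  (forall n, exists2 A', (A' <= A)%N & cost_within A' B (w n)) ->
  cost_within A B (w n0) -> cost_within A B (parallel_time M w).
Proof.
move=> hw /andP[hlo _]; apply: parallel_time_bounds hlo => n.
by have [A' leA] := hw n; apply: cost_within_le.
Qed.

(** The budget [1] lets idle processors share the bound of busy ones. *)
Lemma within0 : cost_within 0 1 0.
Proof.
rewrite /cost_within mul0r lexx add0r mul1r.
by rewrite mulr_ge0 ?dominates_eta_ge0 // ltW // step_time_gt0.
Qed.

(** * Phases and serial sweeps *)

Lemma fine_phase_steps k lo s n :
  (lo <= n < M)%N -> (mbar <= done (fine_phase M mbar Tfinal M F c k lo s) k n)%N.
Proof. by move=> hn; rewrite /= /assign eqxx hn /= leq_maxr. Qed.

(** Interval [n0] still lacks exactly [mbar - alpha] steps, so the maximum is attained. The [2]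
    counts the synchronization and the activity of one task. *)
Lemma fine_phase_clock k lo n0 s A B :
  (forall n, (lo <= n < M)%N -> (alpha <= done s k n)%N) ->
  (lo <= n0 < M)%N -> done s k n0 = alpha ->
  cost_within A B (clock s) ->
  cost_within (A + (mbar - alpha)) (B + 2)
    (clock (fine_phase M mbar Tfinal M F c k lo s)).
Proof.
move=> hs /andP[lo_n0 ltn0] hn0 hc /=.
rewrite -[(A + _)%N]addn0 addnAC -[2%N]/(1 + 1)%N addnA.
apply: cost_within_add; first by apply: cost_within_add (other_within _).
apply: (parallel_within (n0 := Ordinal ltn0)) => [n|] /=.
  case: ifP => hn; last by exists 0%N => //; exact: within0.
  exists (mbar - done s k n + 0)%N.
    by rewrite addn0 leq_sub2l // hs // hn ltn_ord.
  by apply: cost_within_add (reach_within _ _) (other_within _).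
rewrite lo_n0 -hn0 -[(mbar - _)%N]addn0.
by apply: cost_within_add (reach_within _ _) (other_within _).
Qed.

(** The fine states used by [G] are available already, so no fine step is added; the idle interval 0
    serves for the lower bound. *)
Lemma first_coarse_clock s A B :
  (0 < M)%N -> (forall n, (0 < n < M)%N -> (alpha <= done s 0 n)%N) ->
  cost_within A B (clock s) ->
  cost_within A (B + 2) (clock (first_coarse_phase M M G c s)).
Proof.
move=> M0 hs hc /=; rewrite -[A]addn0 -[A]addn0 -[2%N]/(1 + 1)%N addnA.
apply: cost_within_add; first by apply: cost_within_add (other_within _).
have hw n : (0 < n < M)%N ->
    cost_within 0 1 (reach_time c (cp_steps G) (xs s 0 n)
                     + other_time c (FirstCoarse n)).
  move=> /hs /eqP hn; move: (reach_within (cp_steps G) (xs s 0 n)).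
  rewrite {1}G_steps hn => hr.
  exact: cost_within_add hr (other_within _).
apply: (parallel_within (n0 := Ordinal M0)) => [n|] /=; last exact: within0.
by exists 0%N => //; case: ifP => hn; [apply: hw; rewrite hn ltn_ord|exact: within0].
Qed.

Lemma init_loop l :
  let s := foldl (init_step G0 c) (start x0) (iota 0 l) in
  [/\ done s 0 l = 0%N, forall n, (n < l)%N -> done s 0 n = alpha
    & cost_within (alpha * l) l (clock s)].
Proof.
elim: l => [|l [IHl IHn IHc]].
  by split=> //; rewrite muln0 /= -[X in cost_within _ _ X](mul0r tau) steps_within.
rewrite (_ : iota 0 l.+1 = iota 0 l ++ [:: l]); last first.
  by rewrite -[l.+1]addn1 iotaD.
rewrite foldl_cat; set s := foldl _ _ (iota 0 l) in IHl IHn IHc *.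
rewrite /=; split.
- by rewrite /assign1 /assign eqxx leqnn ltnS leqnn.
- move=> n; rewrite ltnS leq_eqVlt /assign1 /assign eqxx /=.
  have [->|_] /= := eqVneq n l.
    by rewrite ltnn leqnn ltnSn /= IHl G0_steps max0n.
  by move=> ltn; do 2![rewrite ifF; last lia]; exact: IHn.
- rewrite mulnS addnC -[l.+1]addn1 -[(_ + alpha)%N]addn0.
  apply: cost_within_add (other_within _); rewrite -[l in cost_within _ l]addn0.
  apply: cost_within_add IHc _.
  by have := reach_within (cp_steps G0) (xs s 0 l); rewrite IHl G0_steps subn0.
Qed.

(** Interval [k] costs no fine step, its first [alpha] steps being done; the [d] states after it are
    fresh and cost [alpha] steps each. *)
Lemma coarse_loop k d s A B :
  (alpha <= done s k.+1 k)%N -> cost_within A B (clock s) ->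
  let s' := foldl (coarse_step G c k) s (iota k d.+1) in
  [/\ done s' k.+1 (k + d.+1) = 0%N, (alpha <= done s' k.+1 k)%N,
      forall n, (k < n < k + d.+1)%N -> done s' k.+1 n = alpha
    & cost_within (A + alpha * d) (B + 2 * d.+1) (clock s')].
Proof.
move=> hk hc; elim: d => [|d IHd].
  rewrite /= /assign1 /assign !eqxx /= addn1 leqnn ltnSn /= ltnn leqnn /=.
  split=> //.
  - by rewrite leq_max hk.
  - by move=> n; lia.
  - rewrite muln0 -[(A + 0)%N]addn0 -[(A + 0 + 0)%N]addn0.
    rewrite muln1 -[2%N]/(1 + 1)%N addnA.
    apply: cost_within_add (other_within _).
    apply: cost_within_add (other_within _).
    rewrite -[B]addn0; apply: cost_within_add hc _.
    have := reach_within (cp_steps G) (xs s k.+1 k).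
    by move: hk => /eqP; rewrite G_steps => ->.
rewrite (_ : iota k d.+2 = iota k d.+1 ++ [:: k + d.+1]%N); last first.
  by rewrite -[d.+2]addn1 iotaD.
rewrite foldl_cat; move: IHd; set s' := foldl _ _ (iota k d.+1).
move=> [IHl IHk IHn IHc] /=; split.
- by rewrite /assign1 /assign eqxx ifT //; lia.
- rewrite /assign1 /assign eqxx /=.
  by do 2![rewrite ifF; last lia].
- move=> n hn; rewrite /assign1 /assign eqxx /= ifF; last lia.
  have [->|ne] := eqVneq n (k + d.+1)%N.
    by rewrite leqnn ltnSn /= IHl G_steps max0n.
  by rewrite ifF ?IHn //; lia.
(* The zeros and ones split both budgets over the summands of the clock: fine steps, [Coarse],
   [Correct]. *)
- have -> : (A + alpha * d.+1 = A + alpha * d + alpha + 0 + 0)%N by lia.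
  have -> : (B + 2 * d.+2 = B + 2 * d.+1 + 0 + 1 + 1)%N by lia.
  apply: cost_within_add (other_within _).
  apply: cost_within_add (other_within _).
  apply: cost_within_add IHc _.
  have := reach_within (cp_steps G) (xs s' k.+1 (k + d.+1)).
  by rewrite IHl G_steps subn0.
Qed.

(** * Loop invariant and speedup *)

Local Notation cs := (critical_steps M mbar alpha).

(* Not sharp: an upper bound of the number of other activities on the critical
   path when the while loop is entered with counter [k]. *)
Definition other_bound (k : nat) : nat := (M + 2 + k * (2 * M + 6))%N.

(** The loop invariant is full propagation of the states. As [k.+1 < M], interval [k.+1] enters the
    fine phase with exactly [alpha] steps done. *)
Lemma iteration_within k s :
  (k.+1 < M)%N -> (forall n, (k <= n < M)%N -> (mbar <= done s k n)%N) ->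
  cost_within (cs k) (other_bound k) (clock s) ->
  let s' := iteration M mbar Tfinal M F G c k
              (tick (other_time c (Test k)) s) in
  (forall n, (k.+1 <= n < M)%N -> (mbar <= done s' k.+1 n)%N) /\
  cost_within (cs k.+1) (other_bound k.+1) (clock s').
Proof.
move=> ltkM hs hc s'; split.
  by move=> n hn; apply: fine_phase_steps; lia.
rewrite {}/s' /iteration; set s1 := tick _ s.
have hc1 : cost_within (cs k) (other_bound k).+1 (clock s1).
  by rewrite -[cs k]addn0 -addn1; apply: cost_within_add (other_within _).
set s2 := if _ then _ else _.
have [hs2 hc2] : (alpha <= done s2 k k)%N /\
    cost_within (cs k) (other_bound k + 3) (clock s2).
  have hkk : (alpha <= done s k k)%N.
    by apply: leq_trans le_alpha _; apply: hs; rewrite leqnn ltnW.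
  rewrite /s2; case: eqP => [k0|_].
    split; first by rewrite k0 /= /assign /= -[X in xs s X X]k0.
    rewrite addnS -addSn -/(1 + 1)%N; apply: first_coarse_clock hc1 => [|n hn].
      by lia.
    by apply: leq_trans le_alpha _; rewrite -[X in xs _ X]k0; apply: hs; lia.
  by split=> //; apply: cost_within_widen hc1; lia.
set s3 := copy c k s2.
have hs3 : (alpha <= done s3 k.+1 k)%N.
  by rewrite /= /assign1 /assign eqxx leqnn ltnSn.
have hc3 : cost_within (cs k) (other_bound k + 4) (clock s3).
  by rewrite -[cs k]addn0 addnS -addn1; apply: cost_within_add (other_within _).
(* The sweep covers interval [k] and [d.+1] fresh ones. *)
have [d dE] : exists d, (M - k = d.+2)%N by exists (M - k - 2)%N; lia.
have := coarse_loop d.+1 hs3 hc3.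
rewrite /coarse_sweep /index_iota dE; set s4 := foldl _ _ _.
move=> [_ hk4 hn4 hc4].
have ME : (k + d.+2 = M)%N by lia.
have := @fine_phase_clock k.+1 k k.+1 s4 _ _ _ _ _ hc4.
rewrite /critical_steps big_ord_recr /= => h.
(* Besides at most [2 * M] activities of the sweep, six remain: one test, two of the first coarse
   phase, one copy, two of the fine phase. *)
have le_B : (other_bound k + 4 + 2 * d.+2 + 2 <= other_bound k.+1)%N.
  by rewrite /other_bound; lia.
apply: cost_within_widen le_B _.
have -> : (M - k.+1 = d.+1)%N by lia.
rewrite !addnA in h *; rewrite -addnA in h *.
apply: h => [n hn||].
- have [->|ne] := eqVneq n k; first by [].
  by rewrite hn4 //; lia.
- lia.
- by apply: hn4; lia.
Qed.

Lemma loop_within k s K t :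
  (k < M)%N -> (forall n, (k <= n < M)%N -> (mbar <= done s k n)%N) ->
  cost_within (cs k) (other_bound k) (clock s) ->
  loop M mbar Tfinal M F eps G c k s K t ->
  (K < M)%N /\ cost_within (cs K) (other_bound K + 1) (clock t).
Proof.
move=> + + + hl; elim: hl => {k s K t} [k s _|k s K t unc _ IH] ltkM hs hc.
  by split=> //; rewrite -[cs k]addn0; apply: cost_within_add (other_within _).
have ltk1M : (k.+1 < M)%N.
  by case/hasP: unc => n; rewrite mem_index_iota => /andP[h1 h2] _; lia.
by have [h1 h2] := iteration_within ltk1M hs hc; apply: IH.
Qed.

(** The [+ 2] stands for the last test and the final replacement. *)
Lemma parareal_within K out :
  (0 < M)%N -> parareal M mbar Tfinal M F x0 eps G0 G c K out ->
  (K < M)%N /\ cost_within (cs K) (other_bound K + 2) (clock out).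
Proof.
move=> M0 [s hl ->]; have [_ hn hc] := init_loop M.
have [|||ltKM h] := loop_within _ _ _ hl => //.
- by move=> n hn'; apply: fine_phase_steps.
- rewrite /critical_steps big_ord0 addn0 /other_bound mul0n addn0.
  rewrite /initialize /index_iota subn0.
  apply: (fine_phase_clock (n0 := 0)) hc => // [n /andP[_ /hn ->] //|].
  exact: hn.
split=> //; rewrite -[cs K]addn0 -[2%N]/(1 + 1)%N addnA.
exact: cost_within_add h (other_within _).
Qed.

(** Dividing both wall times by [tau] reduces this to [ratio_perturbation], the other activities
    being the perturbations. *)
Lemma speedup_within K out :
  (0 < M)%N -> (0 < mbar)%N ->
  parareal M mbar Tfinal M F x0 eps G0 G c K out ->
  (K < M)%N /\
  `|speedup M mbar c out - (mbar * M)%N%:R / (cs K)%:R| <=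
    ((cs K)%:R + (mbar * M)%N%:R * (other_bound K + 2)%N%:R) * eta
      / (cs K)%:R ^+ 2.
Proof.
move=> M0 mbar0 /(parareal_within M0)[ltKM /andP[h1 h2]]; split=> //.
have tau0 := step_time_gt0; have taun0 : tau != 0 by rewrite gt_eqF.
have cs0 : 0 < (cs K)%:R :> R.
  (* Either [alpha = 0] and [mbar - alpha] is positive, or [alpha * M] is. *)
  by rewrite ltr0n /critical_steps; case: (alpha) le_alpha => [|a] le_a; lia.
have := other_within SerialSolve; rewrite /cost_within mul0r add0r mul1r.
move=> /andP[h3 h4].
have := @ratio_perturbation R (mbar * M)%N%:R (cs K)%:R (other_bound K + 2)%N%:R
  eta (other_time c SerialSolve / tau) (clock out / tau - (cs K)%:R).
have -> : (cs K)%:R + (clock out / tau - (cs K)%:R) = clock out / tau by ring.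
have -> : ((mbar * M)%N%:R + other_time c SerialSolve / tau) / (clock out / tau)
    = speedup M mbar c out.
  have out0 : 0 < clock out by apply: lt_le_trans h1; rewrite mulr_gt0.
  by rewrite /speedup /serial_time; field; rewrite taun0 gt_eqF.
apply=> //.
  by rewrite ler_pdivrMr // divr_ge0 // ltW.
rewrite subr_ge0 lerBlDl ler_pdivlMr // h1 ler_pdivrMr //.
Qed.

End WallTime.

Theorem theorem4p4 (R : realType) (N Nbar M mbar m alpha a p : nat)
  (Tfinal eps : R)
  (F : 'cV[R]_N -> R -> R -> 'cV[R]_N) (x0 : 'cV[R]_N)
  (Rr P : 'M[R]_(N, Nbar)) (Xi : nat -> 'I_Nbar -> 'M[R]_(mbar, a))
  (hN : (0 < N)%N) (hM : (0 < M)%N) (hmbar : (0 < mbar)%N)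
  (hm : m = (mbar * M)%N) (hT : 0 < Tfinal)
  (hNbar : (1 <= Nbar <= N)%N)
  (halpha : (1 <= alpha <= mbar)%N) (ha : (a <= alpha)%N)
  (hXi : forall (n : nat) (j : 'I_Nbar), (n < M)%N ->
     (Xi n j)^T *m Xi n j = 1%:M)
  (hF : fine_propagator M mbar Tfinal F)
  (hp : p = M) (K : nat) :
  let GLF := local_forecast M alpha Tfinal F Rr P Xi in
  let converges c out :=
    parareal M mbar Tfinal p F x0 eps GLF GLF c K out in
  let S_LFLF : R :=
    m%:R / ((alpha%:R * (M%:R - K%:R / 2) + mbar%:R) * (K%:R + 1)
            - alpha%:R * (K%:R + 1)) in
  (* all other costs neglected *)
  (forall (c : costs R) (out : pstate R N),
     fine_step_dominates 0 c -> converges c out ->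
     speedup M mbar c out = S_LFLF)
  /\
  (* limit in which the cost of a fine time step dominates all other costs *)
  (forall delta : R, 0 < delta -> exists2 eta : R, 0 < eta &
     forall (c : costs R) (out : pstate R N),
       fine_step_dominates eta c -> converges c out ->
       `|speedup M mbar c out - S_LFLF| <= delta).
Proof.
move=> GLF converges S; subst m p; have /andP[_ le_am] := halpha.
set T : R := (critical_steps M mbar alpha K)%:R.
set C : R := (T + (mbar * M)%N%:R * (other_bound M K + 2)%N%:R) / T ^+ 2.
have bound eta c out : fine_step_dominates eta c -> converges c out ->
    `|speedup M mbar c out - S| <= C * eta.
  move=> dom conv.
  have [ltKM] := speedup_within (erefl (cp_steps GLF)) erefl le_am dom hM hmbar conv.
  by rewrite /S -(critical_stepsE _ _ _ _ _ le_am ltKM) /C [_ / _ * eta]mulrAC; apply.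
split=> [c out dom conv|delta delta0].
  (* At [eta = 0] the linear bound vanishes, which gives equality. *)
  have := bound _ _ _ dom conv; rewrite mulr0 normr_le0 subr_eq0.
  by move/eqP.
have C0 : 0 <= C by rewrite divr_ge0 ?exprn_ge0 ?addr_ge0 ?mulr_ge0 ?ler0n.
(* The added 1 keeps the denominator positive when [C] is only known to be nonnegative. *)
exists (delta / (C + 1)); first by rewrite divr_gt0 // ltr_wpDl.
move=> c out dom conv; apply: le_trans (bound _ _ _ dom conv) _.
by rewrite mulrA ler_pdivrMr ?ltr_wpDl // mulrC ler_pM2l // lerDl.
Qed.
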